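(* Let $P:[0,1]^2\to[0,\infty)$ be continuous with $\int_0^1P(x,y)\,dy=1$ for all $x\in[0,1]$, and assume that $P$ has a unique invariant density $\theta$, which is positive and continuous. Let $\phi:[0,1]\to(0,\infty)$ be continuous and bounded, and let $\tilde{\mathcal L}$ be the infinitesimal generator acting on bounded measurable $f:[0,1]\to\mathbb{R}$ by $$(\tilde{\mathcal L}f)(x)=\int_0^1[f(y)-f(x)]\frac{\phi(y)}{\phi(x)}P(x,y)\,dy=\tilde\gamma(x)\int_0^1[f(y)-f(x)]\,\tilde Q(x,y)\,dy ,$$ where $\tilde\gamma(x)=\int_0^1\frac{\phi(y)}{\phi(x)}P(x,y)\,dy$ and $\tilde Q(x,y)=\frac{\phi(y)P(x,y)}{\phi(x)\tilde\gamma(x)}$. Then the invariant probability for $\tilde{\mathcal L}$ is $$\tilde\mu(dx)=\frac{\phi(x)\,\tilde\ell_\phi(x)}{\|\phi\|\,\|\tilde\ell_\phi\|}\,dx ,$$ where $\tilde\ell_\phi:[0,1]\to(0,\infty)$ satisfies, for all $x\in[0,1]$, $$\frac{1}{\tilde\ell_\phi(x)}\int_0^1\tilde\ell_\phi(y)P(y,x)\,dy=\tilde\gamma(x).$$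
   Context: A density $\theta$ is invariant for $P$ if $\int_0^1\theta(y)P(y,x)\,dy=\theta(x)$ for all $x$. A probability $g(x)\,dx$ on $[0,1]$ is invariant for $\tilde{\mathcal L}$ if $\tilde{\mathcal L}^*g=0$, where $\tilde{\mathcal L}^*$ is the dual of $\tilde{\mathcal L}$ in $L^2([0,1],dx)$, namely $(\tilde{\mathcal L}^*g)(x)=\int_0^1 g(y)\frac{\phi(x)}{\phi(y)}P(y,x)\,dy-\tilde\gamma(x)g(x)$. Here $\|\cdot\|$ is the norm of $L^2([0,1],dx)$.
   Formalization: The printed density need not have mass 1 (e.g. φ=1, P(x,y)=1/2+y gives mass √(12/13)); it is shown that the dual generator annihilates it and that, divided by its total mass, it is the unique invariant probability. *)

(* Defs.v *)
From HB Require Import structures.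
From mathcomp Require Import all_boot all_order all_algebra.
From mathcomp Require Import all_classical all_reals all_analysis.
Set Implicit Arguments.
Unset Strict Implicit.
Unset Printing Implicit Defensive.
Import Order.TTheory GRing.Theory Num.Theory.
Import numFieldNormedType.Exports.
Local Open Scope classical_set_scope.
Local Open Scope ring_scope.

(* Functions on [0,1] (resp. [0,1]^2) are represented by total functions on R
   (resp. R -> R -> R) whose values outside [0,1] are never used.
   In ring_scope, \int is the real-valued integral [Rintegral], which returns 0
   when the Lebesgue integral is infinite. *)

Notation leb R := (@lebesgue_measure R).
Notation I01 R := [set` Interval (@BSide R true 0%R) (@BSide R false 1%R)].

Section Definitions.
Context {R : realType}.
Implicit Types (P : R -> R -> R) (phi l f g theta : R -> R).

Definition l2norm f : R :=
  fine ('N[leb R]_(2%:E) [EFin \o (f \_ (I01 R))%FUN])%E.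

(* [\int = 1] excludes the default value 0, hence forces integrability. *)
Definition is_density g : Prop :=
  [/\ measurable_fun (I01 R) g,
      (forall x, 0 <= x <= 1 -> 0 <= g x) &
      \int[leb R]_(x in I01 R) g x = 1].

Definition invariant_density P theta : Prop :=
  is_density theta /\
  forall x, 0 <= x <= 1 ->
    \int[leb R]_(y in I01 R) (theta y * P y x) = theta x.

Definition jump_rate phi P (x : R) : R :=
  \int[leb R]_(y in I01 R) (phi y / phi x * P x y).

Definition jump_kernel phi P (x y : R) : R :=
  phi y * P x y / (phi x * jump_rate phi P x).

Definition generator phi P f (x : R) : R :=
  \int[leb R]_(y in I01 R) ((f y - f x) * (phi y / phi x) * P x y).

Definition dual_generator phi P g (x : R) : R :=
  \int[leb R]_(y in I01 R) (g y * (phi x / phi y) * P y x)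
  - jump_rate phi P x * g x.

(* [g] stands for the probability g(x)dx, which determines [g] only almost
   everywhere; accordingly the equation is an equality of elements of L^2. *)
Definition invariant_probability phi P g : Prop :=
  is_density g /\
  {ae leb R, forall x, 0 <= x <= 1 -> dual_generator phi P g x = 0}.

(* The right-hand side being positive, the equation excludes an infinite
   integral (which would be read as 0). *)
Definition is_ell phi P l : Prop :=
  [/\ measurable_fun (I01 R) l,
      (forall x, 0 <= x <= 1 -> 0 < l x) &
      forall x, 0 <= x <= 1 ->
        (l x)^-1 * \int[leb R]_(y in I01 R) (l y * P y x) =
        jump_rate phi P x].

(* This density has total mass <phi, l> / (||phi|| ||l||), which is 1 only if l
   is proportional to phi; [normalize] turns it into a probability density. *)
Definition mu_density phi l (x : R) : R :=
  phi x * l x / (l2norm phi * l2norm l).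

Definition normalize g (x : R) : R :=
  g x / \int[leb R]_(y in I01 R) g y.

End Definitions.

(* Main.v *)
(* With w(x) = \int phi(y) P(x,y) dy, the kernel Q(x,y) = phi(y) P(x,y) / w(x) is
   stochastic, bounded, and vanishes only where P does. A function l solves the
   equation of the theorem iff w l is Q-invariant, and a density g is invariant
   for the generator iff w g / phi is Q-invariant; hence g = phi l up to a
   constant.

   A nonzero Q-invariant function exists without any compactness argument: the
   limsup h of the iterates of 1 under Q satisfies h <= hQ, with equal integrals.
   The set where a Q-invariant function is positive is absorbing for Q, hence for
   P, so restricting theta to it yields a P-invariant density; as theta is the
   only one and is positive, a Q-invariant function is either 0 or positive
   everywhere. Applied to f - min(f, g), this shows that two Q-invariant
   functions f (integrable) and g satisfy f <= g or g < f almost everywhere,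
   which gives both uniqueness and the integrability of every solution l. *)
Require Import Defs.
From HB Require Import structures.
From mathcomp Require Import all_boot all_order all_algebra.
From mathcomp Require Import all_classical all_reals all_analysis.
From mathcomp Require Import measurable_realfun.
From mathcomp Require Import ring lra.
Set Implicit Arguments.
Unset Strict Implicit.
Unset Printing Implicit Defensive.
Import Order.TTheory GRing.Theory Num.Theory.
Import numFieldNormedType.Exports.
Local Open Scope classical_set_scope.
Local Open Scope ring_scope.

(** * Integrals over a product domain *)

Section integrals_on_product_domain.
Context {d} {T : measurableType d} {R : realType}.
Variables (mu : {sigma_finite_measure set T -> \bar R}).
Variables (D : set T) (mD : measurable D).
Implicit Types F : T * T -> \bar R.
Local Open Scope ereal_scope.

Lemma measurable_fst_setX d' (U : measurableType d') (f : T -> U) :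
  measurable_fun D f -> measurable_fun (D `*` D) (fun z => f z.1).
Proof.
move=> mf; apply: (measurable_comp mD _ mf) => //.
  by move=> _ [z [Dz1 _] <-].
by apply: measurable_funTS; exact: measurable_fst.
Qed.

Lemma measurable_snd_setX d' (U : measurableType d') (f : T -> U) :
  measurable_fun D f -> measurable_fun (D `*` D) (fun z => f z.2).
Proof.
move=> mf; apply: (measurable_comp mD _ mf) => //.
  by move=> _ [z [_ Dz2] <-].
by apply: measurable_funTS; exact: measurable_snd.
Qed.

Lemma measurable_pair1_setX d' (U : measurableType d') (f : T * T -> U) x :
  measurable_fun (D `*` D) f -> D x -> measurable_fun D (fun y => f (x, y)).
Proof.
move=> mf Dx; apply: (measurable_comp (measurableX mD mD) _ mf).
  by move=> _ [y Dy <-].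
by apply: measurable_funTS; exact: pair1_measurable.
Qed.

Lemma measurable_pair2_setX d' (U : measurableType d') (f : T * T -> U) y :
  measurable_fun (D `*` D) f -> D y -> measurable_fun D (fun x => f (x, y)).
Proof.
move=> mf Dy; apply: (measurable_comp (measurableX mD mD) _ mf).
  by move=> _ [x Dx <-].
by apply: measurable_funTS; exact: pair2_measurable.
Qed.

(** Extending F by zero off the square turns iterated integrals over D into integrals over the whole
    space, where the Fubini theorems apply directly. *)
Lemma integral_patch_setX1 F :
  (fun x => \int[mu]_y (F \_ (D `*` D)) (x, y)) =
  (fun x => \int[mu]_(y in D) F (x, y)) \_ D.
Proof.
apply/funext => x; rewrite patchE; case: ifPn => xD; last first.
  under eq_integral do rewrite patchE in_setX (negbTE xD) /=.
  by rewrite integral0.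
rewrite [RHS]integral_mkcond; apply: eq_integral => y _.
by rewrite !patchE in_setX xD.
Qed.

Lemma integral_patch_setX2 F :
  (fun y => \int[mu]_x (F \_ (D `*` D)) (x, y)) =
  (fun y => \int[mu]_(x in D) F (x, y)) \_ D.
Proof.
apply/funext => y; rewrite patchE; case: ifPn => yD; last first.
  under eq_integral do rewrite patchE in_setX (negbTE yD) andbF /=.
  by rewrite integral0.
rewrite [RHS]integral_mkcond; apply: eq_integral => x _.
by rewrite !patchE in_setX yD andbT.
Qed.

Lemma measurable_patch_setX F :
  measurable_fun (D `*` D) F -> measurable_fun setT (F \_ (D `*` D)).
Proof. by move/(measurable_restrictT F (measurableX mD mD)). Qed.

Lemma measurable_integral_setX1 F : measurable_fun (D `*` D) F ->
  (forall x y, D x -> D y -> 0 <= F (x, y)) ->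
  measurable_fun D (fun x => \int[mu]_(y in D) F (x, y)).
Proof.
move=> mF F0; apply/(measurable_restrictT _ mD); rewrite -integral_patch_setX1.
apply: (measurable_fun_fubini_tonelli_F (F \_ (D `*` D))).
  exact: measurable_patch_setX.
by apply: erestrict_ge0 => -[x y] [/= Dx Dy]; exact: F0.
Qed.

Lemma measurable_integral_setX2 F : measurable_fun (D `*` D) F ->
  (forall x y, D x -> D y -> 0 <= F (x, y)) ->
  measurable_fun D (fun y => \int[mu]_(x in D) F (x, y)).
Proof.
move=> mF F0; apply/(measurable_restrictT _ mD); rewrite -integral_patch_setX2.
apply: (measurable_fun_fubini_tonelli_G (F \_ (D `*` D))).
  exact: measurable_patch_setX.
by apply: erestrict_ge0 => -[x y] [/= Dx Dy]; exact: F0.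
Qed.

Lemma fubini_tonelli_setX F : measurable_fun (D `*` D) F ->
  (forall x y, D x -> D y -> 0 <= F (x, y)) ->
  \int[mu]_(x in D) \int[mu]_(y in D) F (x, y) =
  \int[mu]_(y in D) \int[mu]_(x in D) F (x, y).
Proof.
move=> mF F0.
rewrite [LHS]integral_mkcond [RHS]integral_mkcond.
rewrite -integral_patch_setX1 -integral_patch_setX2.
apply: (fubini_tonelli (F \_ (D `*` D))).
  exact: measurable_patch_setX.
by apply: erestrict_ge0 => -[x y] [/= Dx Dy]; exact: F0.
Qed.

Lemma Fubini_setX F : measurable_fun (D `*` D) F ->
  \int[mu]_(x in D) \int[mu]_(y in D) `|F (x, y)| < +oo ->
  mu.-integrable D (fun x => \int[mu]_(y in D) F (x, y)) /\
  \int[mu]_(x in D) \int[mu]_(y in D) F (x, y) =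
  \int[mu]_(y in D) \int[mu]_(x in D) F (x, y).
Proof.
move=> mF Foo.
have iF : (mu \x mu).-integrable setT (F \_ (D `*` D)).
  apply/integrable12ltyP; first exact: measurable_patch_setX.
  apply: le_lt_trans Foo; rewrite le_eqVlt; apply/orP; left; apply/eqP.
  rewrite [RHS]integral_mkcond -(integral_patch_setX1 (abse \o F)).
  apply: eq_integral => x _; apply: eq_integral => y _.
  by rewrite restrict_abse.
split.
- apply/(integrable_mkcond _ mD); rewrite -integral_patch_setX1.
  exact: integrable_fubini_F.
- rewrite [LHS]integral_mkcond [RHS]integral_mkcond.
  rewrite -integral_patch_setX1 -integral_patch_setX2.
  exact: Fubini.
Qed.

End integrals_on_product_domain.

(** * Stochastic kernels *)

Section stochastic_kernels.
Context {d} {T : measurableType d} {R : realType}.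
Variables (mu : {sigma_finite_measure set T -> \bar R}).
Variables (D : set T) (mD : measurable D).
Implicit Types (f g : T -> \bar R) (k : T -> T -> R).
Local Open Scope ereal_scope.

Definition ge0_measurable f :=
  measurable_fun D f /\ forall x, D x -> 0 <= f x.

Definition stochastic k :=
  [/\ measurable_fun (D `*` D) (fun z => k z.1 z.2),
      forall x y, D x -> D y -> (0 <= k x y)%R &
      forall x, D x -> \int[mu]_(y in D) (k x y)%:E = 1].

(** If f is the density of a measure, this is the density of its image under the kernel k. Extended
    values make it meaningful for every nonnegative measurable f, integrable or not. *)
Definition push k f (x : T) := \int[mu]_(y in D) (f y * (k y x)%:E).

(** The difference g - f is nonnegative almost everywhere and its integral vanishes; finiteness of
    the common integral permits the subtraction. *)
Lemma ae_eq_le_integral f g : ge0_measurable f -> ge0_measurable g ->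
  {ae mu, forall x, D x -> f x <= g x} ->
  \int[mu]_(x in D) g x = \int[mu]_(x in D) f x ->
  \int[mu]_(x in D) f x < +oo -> ae_eq mu D f g.
Proof.
move=> [mf f0] [mg g0] fg gf foo.
have intf : mu.-integrable D f.
  apply/integrableP; split => //; rewrite (eq_integral f)// => x /set_mem Dx.
  by rewrite gee0_abs// f0.
have intg : mu.-integrable D g.
  apply/integrableP; split => //.
  rewrite (eq_integral g) ?gf// => x /set_mem Dx.
  by rewrite gee0_abs// g0.
have : \int[mu]_(x in D) `|(g \- f) x| = 0.
  have -> : \int[mu]_(x in D) `|(g \- f) x| = \int[mu]_(x in D) (g \- f) x.
    apply: ae_eq_integral => //.
    - by apply: measurableT_comp => //; exact: emeasurable_funB.
    - exact: emeasurable_funB.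
    - apply: filterS2 fg (integrable_ae mD intf) => x fgx fin_f Dx /=.
      by rewrite gee0_abs// suber_ge0 ?fgx ?fin_f.
  rewrite [LHS](integralB mD intg intf) gf subee//.
  exact: integrable_fin_num.
move/(ae_eq_integral_abs _ mD (emeasurable_funB mg mf)) => gf0.
have := integrable_ae mD intf; apply: filterS2 gf0 => x gf0 ff Dx.
move: (gf0 Dx) (ff Dx) => /=; case: (f x) => // r; case: (g x) => //= s.
by move=> [] /eqP; rewrite subr_eq0 => /eqP ->.
Qed.

Lemma push_ge0 k f : stochastic k -> ge0_measurable f ->
  ge0_measurable (push k f).
Proof.
move=> [mk k0 _] [mf f0]; split; last first.
  move=> x Dx; apply: integral_ge0 => y Dy.
  by rewrite mule_ge0 ?f0// lee_fin k0.
apply: (measurable_integral_setX2 mu mD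
  (F := fun z => f z.1 * (k z.1 z.2)%:E)) => //.
  apply: emeasurable_funM; last exact/measurable_EFinP.
  exact: measurable_fst_setX.
by move=> x y Dx Dy; rewrite mule_ge0 ?f0// lee_fin k0.
Qed.

Lemma section_ge0 k f x : stochastic k -> ge0_measurable f -> D x ->
  ge0_measurable (fun y => f y * (k y x)%:E).
Proof.
move=> [mk k0 _] [mf f0] Dx; split; last first.
  by move=> y Dy; rewrite mule_ge0 ?f0// lee_fin k0.
apply: emeasurable_funM => //; apply/measurable_EFinP.
exact: (measurable_pair2_setX mD mk).
Qed.

(** By Tonelli the target variable can be integrated first, and each k(y, .) has mass 1. *)
Lemma push_mass k f : stochastic k -> ge0_measurable f ->
  \int[mu]_(x in D) push k f x = \int[mu]_(x in D) f x.
Proof.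
move=> sk gf; have [mk k0 k1] := sk; have [mf f0] := gf.
rewrite -(fubini_tonelli_setX mu mD (F := fun z => f z.1 * (k z.1 z.2)%:E)).
- apply: eq_integral => y /set_mem Dy /=.
  rewrite ge0_integralZl ?k1 ?mule1 ?f0//.
  + apply/measurable_EFinP.
    exact: (measurable_pair1_setX mD mk).
  + by move=> x Dx; rewrite lee_fin k0.
- apply: emeasurable_funM; last exact/measurable_EFinP.
  exact: measurable_fst_setX.
- by move=> x y Dx Dy; rewrite mule_ge0 ?f0// lee_fin k0.
Qed.

Lemma le_push k f g x : stochastic k -> ge0_measurable f -> ge0_measurable g ->
  {ae mu, forall y, D y -> f y <= g y} -> D x -> push k f x <= push k g x.
Proof.
move=> sk gf gg fg Dx.
have [mfk fk0] := section_ge0 sk gf Dx; have [mgk gk0] := section_ge0 sk gg Dx.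
apply: ae_ge0_le_integral => //; apply: filterS fg => y fgy Dy.
by have [_ k0 _] := sk; rewrite lee_wpmul2r ?fgy// lee_fin k0.
Qed.

(** A bounded kernel is smoothing: one application turns a bound on the integral into a pointwise
    bound. *)
Lemma push_le_bound k (M : R) f x : stochastic k -> ge0_measurable f ->
  (forall y, D y -> (k y x <= M)%R) -> D x ->
  push k f x <= M%:E * \int[mu]_(y in D) f y.
Proof.
move=> sk gf kM Dx; have [mf f0] := gf; have [mfk fk0] := section_ge0 sk gf Dx.
have M0 : 0 <= M%:E.
  by have [_ k0 _] := sk; rewrite lee_fin (le_trans (k0 x x Dx Dx))// kM.
rewrite -ge0_integralZl//; apply: ge0_le_integral => //.
  exact: measurable_funeM.
by move=> y Dy; rewrite muleC lee_wpmul2r ?f0// lee_fin kM.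
Qed.

Lemma push_fin_num k (M : R) f x : stochastic k -> ge0_measurable f ->
  (forall y, D y -> (k y x <= M)%R) -> \int[mu]_(y in D) f y < +oo -> D x ->
  push k f x \is a fin_num.
Proof.
move=> sk gf kM foo Dx; have [_ /(_ x Dx) p0] := push_ge0 sk gf.
rewrite ge0_fin_numE//; apply: le_lt_trans (push_le_bound sk gf kM Dx) _.
have M0 : 0 <= M%:E.
  by have [_ k0 _] := sk; rewrite lee_fin (le_trans (k0 x x Dx Dx))// kM.
by rewrite lte_mul_pinfty.
Qed.

Lemma ae_eq_push k f g x : stochastic k ->
  ge0_measurable f -> ge0_measurable g ->
  ae_eq mu D f g -> D x -> push k f x = push k g x.
Proof.
move=> sk gf gg fg Dx; apply/eqP; rewrite eq_le !le_push//.
- by apply: filterS fg => y fgy Dy; rewrite fgy.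
- by apply: filterS fg => y fgy Dy; rewrite fgy.
Qed.

Lemma pushD k f g x : stochastic k -> ge0_measurable f -> ge0_measurable g ->
  D x -> push k (f \+ g) x = push k f x + push k g x.
Proof.
move=> sk gf gg Dx.
have [mfk fk0] := section_ge0 sk gf Dx; have [mgk gk0] := section_ge0 sk gg Dx.
rewrite -ge0_integralD//; apply: eq_integral => y /set_mem Dy /=.
by have [_ f0] := gf; have [_ g0] := gg; rewrite ge0_muleDl ?f0 ?g0.
Qed.

Lemma pushZ k f c x : stochastic k -> ge0_measurable f -> 0 <= c ->
  D x -> push k (fun y => c * f y) x = c * push k f x.
Proof.
move=> sk gf c0 Dx; have [mfk fk0] := section_ge0 sk gf Dx.
by rewrite -ge0_integralZl//; apply: eq_integral => y _; rewrite muleA.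
Qed.

Lemma ge0_measurableZ f c : 0 <= c -> ge0_measurable f ->
  ge0_measurable (fun y => c * f y).
Proof.
move=> c0 [mf f0]; split; first exact: measurable_funeM.
by move=> x Dx; rewrite mule_ge0 ?f0.
Qed.

(** Conservation of mass leaves no room for strict inequality on a set of positive measure. *)
Lemma push_subinvariant k f : stochastic k -> ge0_measurable f ->
  \int[mu]_(x in D) f x < +oo ->
  {ae mu, forall x, D x -> push k f x <= f x} -> ae_eq mu D (push k f) f.
Proof.
move=> sk gf foo le; apply: ae_eq_le_integral => //; first exact: push_ge0.
- by rewrite push_mass.
- by rewrite push_mass.
Qed.

Lemma push_superinvariant k f : stochastic k -> ge0_measurable f ->
  \int[mu]_(x in D) f x < +oo ->
  {ae mu, forall x, D x -> f x <= push k f x} -> ae_eq mu D (push k f) f.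
Proof.
move=> sk gf foo le; apply: ae_eq_sym.
apply: ae_eq_le_integral => //; first exact: push_ge0.
by rewrite push_mass.
Qed.

(** [push] ignores null sets, so replacing f by [push k f] upgrades invariance almost everywhere to
    invariance at every point. *)
Lemma push_ae_invariant k f x : stochastic k -> ge0_measurable f ->
  ae_eq mu D (push k f) f -> D x -> push k (push k f) x = push k f x.
Proof. by move=> sk gf ff Dx; apply: ae_eq_push => //; exact: push_ge0. Qed.

End stochastic_kernels.

(** * Existence of an invariant function *)

Section invariant_function.
Context {d} {T : measurableType d} {R : realType}.
Variables (mu : {sigma_finite_measure set T -> \bar R}).
Variables (D : set T) (mD : measurable D).
Local Open Scope ereal_scope.

Lemma integrable_bounded_ereal (f : T -> \bar R) (C : R) : mu D < +oo ->
  measurable_fun D f -> (forall x, D x -> `|f x| <= C%:E) ->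
  mu.-integrable D f.
Proof.
move=> Doo mf fC; apply/integrableP; split => //.
have := integral_le_bound (mu := mu) C%:E mD mf.
case: (pselect (D !=set0)) => [[x Dx]|/nonemptyPn ->]; last first.
  by rewrite integral_set0.
have C0 : 0 <= C%:E by exact: le_trans (fC _ Dx).
by move=> /(_ C0 (aeW mu fC)) /le_lt_trans; apply; rewrite lte_mul_pinfty.
Qed.

(* The limsup h of the iterates of the constant function 1 satisfies
   h <= push k h by dominated convergence; both sides have the same integral. *)
Lemma exists_push_invariant (k : T -> T -> R) (M : R) :
  stochastic mu D k -> (forall x y, D x -> D y -> (k x y <= M)%R) ->
  0 < mu D < +oo ->
  exists h, [/\ ge0_measurable D h,
    forall x, D x -> push mu D k h x = h x,
    0 < \int[mu]_(x in D) h x < +oo &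
    forall x, D x -> h x \is a fin_num].
Proof.
move=> sk kM /andP[D0 Doo]; have [mk k0 k1] := sk.
(* Starting after one application of the kernel makes the bound C = M mu(D) hold for every term. *)
pose h n : T -> \bar R := iter n.+1 (push mu D k) (cst 1).
have g1 : ge0_measurable D (cst 1 : T -> \bar R).
  by split; [exact: measurable_cst|move=> x _; exact: lee01].
have gh n : ge0_measurable D (h n).
  by elim: n => [|n ih]; apply: push_ge0.
have ih n : \int[mu]_(x in D) h n x = mu D.
  elim: n => [|n ih]; rewrite /h /= push_mass//; last exact: gh.
  by rewrite integral_cst// mul1e.
have [x0 Dx0] : D !=set0.
  by apply/set0P/eqP => D_0; move: D0; rewrite D_0 measure0 ltxx.
have M0 : (0 <= M)%R by exact: le_trans (k0 x0 x0 Dx0 Dx0) (kM _ _ Dx0 Dx0).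
pose C := (M * fine (mu D))%R.
have Dfin : mu D \is a fin_num by rewrite ge0_fin_numE.
have C0 : (0 <= C)%R by rewrite mulr_ge0// fine_ge0.
have push_leC f x : ge0_measurable D f -> \int[mu]_(y in D) f y = mu D -> D x ->
    push mu D k f x <= C%:E.
  move=> gf fD Dx; rewrite EFinM fineK// -fD.
  by apply: push_le_bound => // y Dy; exact: kM.
have hC n x : D x -> h n x <= C%:E.
  move=> Dx; case: n => [|n]; apply: push_leC => //.
  - by rewrite integral_cst// mul1e.
  - exact: gh.
  - exact: ih.
(* The tail suprema v n decrease to the limsup u, so they converge even if the iterates do not. *)
pose v n x := esups (h ^~ x) n.
pose u x := limn_esup (h ^~ x).
have uE t : u t = ereal_inf (range (v ^~ t)).
  by rewrite /u limn_esup_lim; apply/cvg_lim => //; exact: cvg_esups_inf.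
have vu t : v ^~ t @ \oo --> u t by rewrite uE; exact: cvg_esups_inf.
have uv : forall n x, u x <= v n x.
  by move=> n x; rewrite uE; apply: ereal_inf_lbound; exists n.
have hv : forall m n x, (n <= m)%N -> h m x <= v n x.
  by move=> m n x nm; apply: ereal_sup_ubound; exists m.
have vC : forall n x, D x -> v n x <= C%:E.
  by move=> n x Dx; apply: ge_ereal_sup => _ [m _ <-]; exact: hC.
have gv : forall n, ge0_measurable D (v n).
  move=> n; split; first by apply: measurable_fun_esups => m; have [] := gh m.
  by move=> x Dx; apply: le_trans (hv n n x _) => //; have [_] := gh n; exact.
have gu : ge0_measurable D u.
  split; first by apply: measurable_fun_limn_esup => m; have [] := gh m.
  by move=> x Dx; rewrite uE; apply: le_ereal_inf_tmp => _ [n _ <-];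
    have [_] := gv n; exact.
have uC : forall x, D x -> u x <= C%:E.
  by move=> x Dx; exact: le_trans (uv 0%N x) (vC _ _ Dx).
(* This is used with c = 1, for the mass of u, and with c = k(., x), for [push] of u at x. *)
have lim_v (c : T -> R) (K : R) : measurable_fun D c ->
    (forall x, D x -> 0 <= c x <= K)%R ->
    \int[mu]_(x in D) (v n x * (c x)%:E) @[n --> \oo] -->
    \int[mu]_(x in D) (u x * (c x)%:E).
  move=> mc cK.
  have [|||||_ _] := @dominated_convergence _ _ _ mu D mD
    (fun n x => v n x * (c x)%:E) (fun x => u x * (c x)%:E) (cst (C * K)%:E).
  - move=> n; apply: emeasurable_funM; first by have [] := gv n.
    exact/measurable_EFinP.
  - apply: emeasurable_funM; first by have [] := gu.
    exact/measurable_EFinP.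
  - by apply: aeW => x Dx; apply: cvgeZr => //; exact: vu.
  - apply: (@integrable_bounded_ereal _ `|C * K|%R) => //.
  - apply: aeW => x n Dx; have /andP[c0 cK'] := cK x Dx.
    have [_ v0] := gv n.
    rewrite gee0_abs ?mule_ge0 ?v0 ?lee_fin//= EFinM lee_pmul ?v0 ?lee_fin//.
    exact: vC.
  - exact: id.
have u_foo : \int[mu]_(x in D) u x < +oo.
  apply: (@le_lt_trans _ _ (\int[mu]_(x in D) (cst C%:E x))); last first.
    by rewrite integral_cst// lte_mul_pinfty.
  by have [mu_ u0] := gu; apply: ge0_le_integral => //; exact: measurable_cst.
(* No mass is lost in the limit, as v n dominates h n, whose mass is mu(D); hence u is not null. *)
have Dle : mu D <= \int[mu]_(x in D) u x.
  have one01 (x : T) : D x -> (0 <= (cst 1 x : R) <= 1)%R.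
    by move=> _; rewrite /= ler01 lexx.
  have cv := lim_v _ _ (measurable_cst _) one01.
  have -> : \int[mu]_(x in D) u x = \int[mu]_(x in D) (u x * (cst 1 x : R)%:E).
    by apply: eq_integral => x _; rewrite mule1.
  rewrite -(cvg_lim _ cv)//; apply: lime_ge.
    by apply/cvg_ex; eexists; exact: cv.
  apply: nearW => n; under eq_integral do rewrite mule1.
  rewrite -(ih n); apply: ge0_le_integral => //.
  - by have [_] := gh n; exact.
  - by have [] := gh n.
  - by have [] := gv n.
  - by move=> x _; exact: hv.
have u_le : forall x, D x -> u x <= push mu D k u x.
  move=> x Dx.
  have kx : forall y, D y -> (0 <= k y x <= M)%R.
    by move=> y Dy; rewrite k0//= kM.
  have cv := lim_v (k ^~ x) M (measurable_pair2_setX mD mk Dx) kx.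
  rewrite /push -(cvg_lim _ cv)//; apply: lime_ge.
    by apply/cvg_ex; eexists; exact: cv.
  apply: nearW => n; apply: le_trans (uv n.+1 x) _.
  (* Every term of index above n is the image of some h m with m >= n, and h m <= v n. *)
  apply: ge_ereal_sup => _ [[//|m] /= nm <-].
  by apply: (le_push mD sk (gh m) (gv n)) => //; apply: aeW => y _; exact: hv.
have pu : ae_eq mu D (push mu D k u) u.
  by apply: push_superinvariant => //; exact: aeW.
exists (push mu D k u); split.
- exact: push_ge0.
- by move=> x Dx; exact: push_ae_invariant.
- by rewrite push_mass// u_foo andbT (lt_le_trans D0).
- by move=> x Dx; apply: (push_fin_num mD (M := M)) => // y Dy; exact: kM.
Qed.

End invariant_function.

(** * Zero-one law and uniqueness *)

Section zero_one_law.
Context {d} {T : measurableType d} {R : realType}.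
Variables (mu : {sigma_finite_measure set T -> \bar R}).
Variables (D : set T) (mD : measurable D).
Local Open Scope ereal_scope.

Lemma ge0_integral_eq0 (f : T -> \bar R) : ge0_measurable D f ->
  \int[mu]_(x in D) f x = 0 -> ae_eq mu D f (cst 0).
Proof.
move=> [mf f0] f_eq0; apply/(ae_eq_integral_abs _ mD mf).
by rewrite -f_eq0; apply: eq_integral => x /set_mem Dx; rewrite gee0_abs ?f0.
Qed.

Variables p q : T -> T -> R.
Hypotheses (sp : stochastic mu D p) (sq : stochastic mu D q).
Hypothesis q0p0 : forall x y, D x -> D y -> q x y = 0%R -> p x y = 0%R.
Variable theta : T -> \bar R.
Hypotheses (gtheta : ge0_measurable D theta)
  (theta_fin : forall x, D x -> theta x \is a fin_num)
  (theta_gt0 : forall x, D x -> 0 < theta x)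
  (theta_oo : \int[mu]_(x in D) theta x < +oo)
  (theta_inv : forall x, D x -> push mu D p theta x = theta x).
(** This is the form in which uniqueness of theta enters the argument: no invariant probability
    density of p has a zero. *)
Hypothesis inv_gt0 : forall t, ge0_measurable D t ->
  (forall x, D x -> t x \is a fin_num) -> \int[mu]_(x in D) t x = 1 ->
  (forall x, D x -> push mu D p t x = t x) -> forall x, D x -> 0 < t x.

(* The set U where f > 0 is absorbing for q, hence for p; so the restriction of
   theta to U is p-invariant up to a null set, and cannot vanish off U. *)
Lemma invariant_zero_one (f : T -> \bar R) : ge0_measurable D f ->
  (forall x, D x -> push mu D q f x = f x) ->
  (forall x, D x -> f x = 0) \/ (forall x, D x -> 0 < f x).
Proof.
move=> gf fE; have [mf f0] := gf; have [mtheta theta0] := gtheta.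
pose U := D `&` f @^-1` `]0, +oo[%classic.
have mU : measurable U by apply: mf => //; exact: emeasurable_itv.
have UP x : D x -> (x \in U) = (0 < f x).
  by move=> Dx; apply/idP/idP => [/set_mem[_]|fx];
    [|apply/mem_set; split => //]; rewrite /= in_itv/= andbT.
pose t := theta \_ U.
have t_le x : D x -> t x <= theta x.
  by move=> Dx; rewrite /t patchE; case: ifPn => // _; exact: theta0.
have gt : ge0_measurable D t.
  split.
    by apply/(measurable_restrict theta mU mD); exact: measurable_funS mtheta.
  by move=> x Dx; rewrite /t patchE; case: ifPn => // _; exact: theta0.
(* If f x = 0, the integrand f(y) q(y, x) vanishes for almost every y. On U this forces q(y, x) = 0,
   hence p(y, x) = 0; off U, t itself is 0. *)
have push_t_eq0 x : D x -> ~~ (0 < f x) -> push mu D p t x = 0.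
  move=> Dx fx; have fx0 : f x = 0.
    by apply/eqP; rewrite eq_le f0// andbT leNgt.
  have := section_ge0 mD sq gf Dx => /ge0_integral_eq0.
  rewrite -/(push mu D q f x).
  rewrite fE// => /(_ fx0) fq0.
  have [mts ts0] := section_ge0 mD sp gt Dx.
  rewrite /push -[RHS](integral0 mu D); apply: ge0_ae_eq_integral => //.
  apply: filterS fq0 => y fq0 Dy; rewrite /t patchE UP//; case: ifPn => fy.
    move: (fq0 Dy) => /= /eqP; rewrite mule_eq0 gt_eqF//= => /eqP [qyx].
    by rewrite q0p0// mule0.
  by rewrite mul0e.
have push_t_le x : D x -> push mu D p t x <= t x.
  move=> Dx; rewrite /t patchE UP//; case: ifPn => [fx|]; last first.
    by move=> fx; rewrite -/t push_t_eq0.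
  by rewrite -/t -[leRHS]theta_inv//; apply: le_push => //; exact: aeW.
have t_oo : \int[mu]_(x in D) t x < +oo.
  by apply: le_lt_trans theta_oo; have [mt t0] := gt; exact: ge0_le_integral.
have pt : ae_eq mu D (push mu D p t) t.
  by apply: push_subinvariant => //; exact: aeW.
(* If t has no mass, then U is null because theta is positive, and f, being its own image under q,
   is 0 at every point. *)
have [t_eq0|t_neq0] := eqVneq (\int[mu]_(x in D) t x) 0.
  left => x Dx; rewrite -fE//.
  rewrite (@ae_eq_push _ _ _ _ _ mD q f (cst 0))//.
  - by rewrite /push; under eq_integral do rewrite mul0e; exact: integral0.
  - apply: filterS (ge0_integral_eq0 gt t_eq0) => y ty Dy.
    apply/eqP; rewrite eq_le f0// andbT leNgt; apply/negP => fy.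
    move: (ty Dy) (theta_gt0 Dy); rewrite /t patchE UP// fy => -> /=.
    by rewrite ltxx.
(* A zero x of f would be a zero of [push mu D p t]. Normalized by its mass m, this function is a
   p-invariant density, everywhere and not only almost everywhere, which contradicts [inv_gt0]. *)
right => x Dx; rewrite ltNge; apply/negP => fx0.
have t_fin : \int[mu]_(x in D) t x \is a fin_num.
  by rewrite ge0_fin_numE//; apply: integral_ge0; have [] := gt.
pose m := fine (\int[mu]_(x in D) t x).
have m_gt0 : (0 < m)%R.
  by rewrite fine_gt0// t_oo andbT lt0e t_neq0 integral_ge0//; have [] := gt.
have m0 : 0 <= (m^-1)%:E by rewrite lee_fin invr_ge0 ltW.
have gpt := push_ge0 mD sp gt.
have := @inv_gt0 (fun x => (m^-1)%:E * push mu D p t x).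
move=> /(_ (ge0_measurableZ m0 gpt)) inv.
suff : 0 < (m^-1)%:E * push mu D p t x.
  by rewrite push_t_eq0 ?mule0 ?ltxx// -leNgt.
apply: inv => //.
- move=> y Dy; rewrite fin_numM// ge0_fin_numE; last by have [_] := gpt; exact.
  apply: le_lt_trans (push_t_le y Dy) _; apply: le_lt_trans (t_le y Dy) _.
  by rewrite -ge0_fin_numE ?theta_fin ?theta0.
- have [mpt pt0] := gpt.
  rewrite ge0_integralZl// push_mass// -[X in _ * X](fineK t_fin) -/m.
  by rewrite -EFinM mulVf// gt_eqF.
- by move=> y Dy; rewrite pushZ// push_ae_invariant.
Qed.

Lemma ae_invariant_zero_one (f : T -> \bar R) : ge0_measurable D f ->
  ae_eq mu D (push mu D q f) f ->
  ae_eq mu D f (cst 0) \/ {ae mu, forall x, D x -> 0 < f x}.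
Proof.
move=> gf fE.
have [z|pos] := invariant_zero_one (push_ge0 mD sq gf)
  (fun x Dx => push_ae_invariant mD sq gf fE Dx).
  by left; apply: filterS fE => x fx Dx; rewrite -fx// z.
by right; apply: filterS fE => x fx Dx; rewrite -fx// pos.
Qed.

(** The minimum m of f and g is subinvariant, and integrable because f is, hence invariant almost
    everywhere. So is e = f - m, and its two cases in the zero-one law are the two alternatives. *)
Lemma ae_invariant_dichotomy (f g : T -> \bar R) :
  ge0_measurable D f -> ge0_measurable D g ->
  (forall x, D x -> f x \is a fin_num) ->
  \int[mu]_(x in D) f x < +oo ->
  ae_eq mu D (push mu D q f) f -> ae_eq mu D (push mu D q g) g ->
  {ae mu, forall x, D x -> f x <= g x} \/ {ae mu, forall x, D x -> g x < f x}.
Proof.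
move=> gf gg ffin foo fE gE; have [mf f0] := gf; have [mg g0] := gg.
pose m x := mine (f x) (g x).
have gm : ge0_measurable D m.
  split; first exact: measurable_mine.
  by move=> x Dx; rewrite le_min f0// g0.
have mE : ae_eq mu D (push mu D q m) m.
  apply: push_subinvariant => //.
    apply: le_lt_trans foo; have [mm m0] := gm; apply: ge0_le_integral => //.
    by move=> x _; rewrite ge_min lexx.
  apply: filterS2 fE gE => x fx gx Dx; rewrite le_min -{1}fx// -gx//.
  by apply/andP; split; apply: le_push => //; apply: aeW => y _;
    rewrite ge_min lexx ?orbT.
have mfin x : D x -> m x \is a fin_num.
  move=> Dx; rewrite ge0_fin_numE; last by have [_] := gm; exact.
  apply: (@le_lt_trans _ _ (f x)); first by rewrite ge_min lexx.
  by rewrite -ge0_fin_numE ?f0 ?ffin.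
pose e x := f x - m x.
have ge : ge0_measurable D e.
  have [mm m0] := gm; split; first exact: emeasurable_funB.
  by move=> x Dx; rewrite suber_ge0 ?mfin// ge_min lexx.
(* Additivity is applied to m + e = f, and the finite value m x is then cancelled. *)
have eE : ae_eq mu D (push mu D q e) e.
  apply: filterS2 fE mE => x fx mx Dx.
  have : push mu D q (m \+ e) x = push mu D q f x.
    by apply: eq_integral => y /set_mem Dy; rewrite /= addeC subeK ?mfin.
  rewrite pushD// mx// fx// => fxE; have -> : e x = f x - m x by [].
  by rewrite -fxE [X in _ = X - _]addeC addeK ?mfin.
have [e0|e0] := ae_invariant_zero_one ge eE; [left|right].
  apply: filterS e0 => x ex Dx; move: (ex Dx) => /= /eqP.
  rewrite sube_eq ?mfin ?ffin// ?fin_num_adde_defl ?mfin// add0e => /eqP ->.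
  by rewrite ge_min lexx orbT.
apply: filterS e0 => x ex Dx; move: (ex Dx); rewrite sube_gt0 /m.
by rewrite gt_min ltxx.
Qed.

(* Otherwise f <= g / n almost everywhere for every n, by the dichotomy. *)
Lemma ae_invariant_integrable (f g : T -> \bar R) :
  ge0_measurable D f -> ge0_measurable D g ->
  (forall x, D x -> f x \is a fin_num) ->
  (forall x, D x -> g x \is a fin_num) ->
  0 < \int[mu]_(x in D) f x < +oo ->
  ae_eq mu D (push mu D q f) f -> ae_eq mu D (push mu D q g) g ->
  \int[mu]_(x in D) g x < +oo.
Proof.
move=> gf gg ffin gfin /andP[fgt0 foo] fE gE.
have [mf f0] := gf; have [mg g0] := gg.
have c0 n : 0 <= (n.+1%:R^-1 : R)%:E by rewrite lee_fin.
have gE' n : ae_eq mu D (push mu D q (fun x => (n.+1%:R^-1)%:E * g x))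
    (fun x => (n.+1%:R^-1)%:E * g x).
  by apply: filterS gE => x gx Dx; rewrite pushZ// gx.
have dich n := ae_invariant_dichotomy gf (ge0_measurableZ (c0 n) gg) ffin foo
  fE (gE' n).
have [[n gn]|nogn] :=
    pselect (exists n, {ae mu, forall x, D x -> (n.+1%:R^-1)%:E * g x < f x}).
  apply: (@le_lt_trans _ _ (\int[mu]_(x in D) (n.+1%:R%:E * f x))).
    apply: ae_ge0_le_integral => //.
    - by move=> x Dx; rewrite mule_ge0 ?f0.
    - exact: measurable_funeM.
    apply: filterS gn => x gn Dx; move: (gn Dx) => /ltW.
    by rewrite muleC lee_pdivrMr// muleC.
  by rewrite ge0_integralZl// lte_mul_pinfty.
have fle n : {ae mu, forall x, D x -> f x <= (n.+1%:R^-1)%:E * g x}.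
  by have [//|gn] := dich n; exfalso; apply: nogn; exists n.
have f_eq0 : ae_eq mu D f (cst 0).
  apply: filterS (ae_foralln fle) => x {}fle Dx /=.
  have := fle ^~ Dx; have := f0 x Dx; have := ffin x Dx; have := gfin x Dx.
  case: (f x) => // r; case: (g x) => // s _ _; rewrite lee_fin => r0 rs.
  congr EFin; apply/eqP; rewrite eq_le r0 andbT leNgt; apply/negP => r_gt0.
  (* With this n, n + 1 exceeds s / r, whereas r <= s / (n + 1) would give n + 1 <= s / r. *)
  have := rs (Num.truncn (s / r)).
  rewrite -EFinM lee_fin mulrC ler_pdivlMr// mulrC -ler_pdivlMr// leNgt.
  by rewrite truncnS_gt.
have : \int[mu]_(x in D) f x = 0.
  rewrite -[RHS](integral0 mu D); apply: ge0_ae_eq_integral => //.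
by move=> f_int0; move: fgt0; rewrite f_int0 ltxx.
Qed.

End zero_one_law.

(** * Measurability of continuous functions and of inverses *)

(** An open set of the plane is the union of the open boxes with rational corners that it contains.
    The union runs over all rational quadruples, unsuitable boxes being replaced by the empty
    set. *)
Lemma open_measurable_prod (R : realType) (U : set (R * R)) :
  open U -> measurable U.
Proof.
move=> oU.
pose box (q : rat * rat * (rat * rat)) : set (R * R) :=
  `]ratr q.1.1, ratr q.1.2[%classic `*` `]ratr q.2.1, ratr q.2.2[%classic.
have -> : U = \bigcup_q (if `[< box q `<=` U >] then box q else set0).
  apply/seteqP; split => [[x y] Uxy|z [q _]]; last first.
    by case: ifPn => // /asboolP qU /qU.
  have /nbhs_ballP[e /= e0 eU] : nbhs (x, y) U by exact: open_nbhs_nbhs.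
  have rat_near (t : R) : exists q : rat * rat,
      ratr q.1 < t < ratr q.2 /\
      forall s, ratr q.1 < s < ratr q.2 -> `|t - s| < e.
    have [a] : exists q : rat, ratr q \in `]t - e, t[.
      by apply: rat_in_itvoo; rewrite ltrBlDr ltrDl.
    have [b] : exists q : rat, ratr q \in `]t, t + e[.
      by apply: rat_in_itvoo; rewrite ltrDl.
    rewrite !in_itv/= => /andP[tb be] /andP[ea at_].
    exists (a, b); split => /=; first by rewrite at_ tb.
    move=> s /andP[as_ sb]; rewrite distrC ltr_distl (lt_trans ea)//=.
    exact: lt_trans be.
  have [qx [xqx qxe]] := rat_near x; have [qy [yqy qye]] := rat_near y.
  exists (qx, qy) => //; rewrite asboolT.
    by split => /=; rewrite in_itv.
  move=> -[s t] [/=]; rewrite !in_itv/= => sqx tqy; apply: eU.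
  by split => /=; [exact: qxe|exact: qye].
apply: countable_bigcupT_measurable => // q.
by case: ifPn => // _; apply: measurableX; exact: measurable_itv.
Qed.

Lemma subspace_continuous_measurable_fun_prod (R : realType) (D : set (R * R))
    (f : R * R -> R) :
  measurable D -> {within D, continuous f} -> measurable_fun D f.
Proof.
move=> mD /continuousP cf; apply: (measurability _ (RGenOpens.measurableE R)).
move=> _ [_ [a [b ->] <-]].
have /open_subspaceP [V oV VD] :=
  cf _ (@interval_open _ (BRight a) (BLeft b) isT isT).
by rewrite setIC -VD; apply: measurableI => //; exact: open_measurable_prod.
Qed.

Lemma measurable_funV_gt0 d (T : measurableType d) (R : realType) (D : set T)
    (f : T -> R) : measurable_fun D f -> (forall x, D x -> 0 < f x) ->
  measurable_fun D (fun x => (f x)^-1).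
Proof.
move=> mf f0.
have mV : measurable_fun (`]0, +oo[%classic : set R) (@GRing.inv R).
  apply: open_continuous_measurable_fun; first exact: interval_open.
  move=> x; rewrite inE/= in_itv/= andbT => x0.
  by apply: inv_continuous; rewrite gt_eqF.
apply: (measurable_comp _ _ mV mf) => //.
by move=> _ [x Dx <-]/=; rewrite in_itv/= f0.
Qed.

Lemma bounded_on_le (R : realType) (U : Type) (D : set U) (f : U -> R) :
  [bounded f x | x in D] ->
  exists2 K : R, 0 < K & forall x, D x -> `|f x| <= K.
Proof.
move=> [K [_ fK]]; exists (Num.max 1 (K + 1)); first by rewrite lt_max ltr01.
move=> x Dx; apply: le_trans (fK (K + 1) _ x Dx) _; first by rewrite ltrDl.
by rewrite le_max lexx orbT.
Qed.

(** * Real-valued and extended-valued integrals *)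

Section ereal_of_real_integrals.
Context {d} {T : measurableType d} {R : realType}.
Variables (mu : {measure set T -> \bar R}) (D : set T) (mD : measurable D).

(* [filterS] does not find the filter instance of the Lebesgue measure when the
   predicates are stated on the type [R] itself. *)
Lemma ae_imply (P Q : T -> Prop) : (forall x, P x -> Q x) ->
  {ae mu, forall x, P x} -> {ae mu, forall x, Q x}.
Proof. by move=> PQ; exact: filterS. Qed.

(** [fine] sends both infinities to 0, so a nonzero value certifies that the extended integral is
    finite. *)
Lemma Rintegral_neq0 (f : T -> R) : \int[mu]_(x in D) f x != 0 ->
  (\int[mu]_(x in D) (f x)%:E = (\int[mu]_(x in D) f x)%:E)%E.
Proof. by rewrite /Rintegral; case: integral => //=; rewrite eqxx. Qed.

Lemma integrable_mul_bounded (f g : T -> R) (K : R) :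
  mu.-integrable D (EFin \o g) -> measurable_fun D f ->
  (forall x, D x -> `|f x| <= K) ->
  mu.-integrable D (fun x => (f x * g x)%:E).
Proof.
move=> ig mf fK; have /measurable_EFinP mg := measurable_int _ ig.
apply: (@le_integrable _ _ _ mu D mD _ (fun x => K%:E * (g x)%:E)%E).
- by apply/measurable_EFinP; exact: measurable_funM.
- move=> x Dx /=; rewrite lee_fin !normrM ler_wpM2r//.
  by apply: le_trans (fK _ Dx) _; exact: ler_norm.
- exact: integrableZl.
Qed.

Lemma RintegralE (f : T -> R) : mu.-integrable D (EFin \o f) ->
  (\int[mu]_(x in D) (f x)%:E = (\int[mu]_(x in D) f x)%:E)%E.
Proof. by move=> intf; rewrite fineK// integrable_fin_num. Qed.

(** Integrability is not assumed: when the integral of f is infinite, a > 0 makes both sides the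
    default value 0. *)
Lemma ge0_RintegralZl (f : T -> R) (a : R) : measurable_fun D f ->
  (forall x, D x -> 0 <= f x) -> 0 < a ->
  \int[mu]_(x in D) (a * f x) = a * \int[mu]_(x in D) f x.
Proof.
move=> mf f0 a0; rewrite /Rintegral.
under eq_integral do rewrite EFinM.
rewrite ge0_integralZl//; [|exact/measurable_EFinP|by rewrite lee_fin ltW].
have : (0 <= \int[mu]_(x in D) (f x)%:E)%E by exact: integral_ge0.
by case: integral => //= _; rewrite gt0_muley ?lte_fin//= mulr0.
Qed.

End ereal_of_real_integrals.

(** * The unit interval and its L^2 norm *)

Lemma I01P (R : realType) (x : R) : I01 R x <-> 0 <= x <= 1.
Proof. by rewrite /= in_itv. Qed.

Section l2norm_unit_interval.
Context {R : realType}.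
Local Notation mu := (leb R).
Local Notation I := (I01 R).

Lemma measurable_I01 : measurable I. Proof. exact: measurable_itv. Qed.

Lemma lebesgue_measure_I01 : mu I = 1%E.
Proof. by rewrite lebesgue_measure_itv/= lte01 oppr0 adde0. Qed.

Let mI := measurable_I01.
Let muI1 := lebesgue_measure_I01.
Let muI_oo : (mu I < +oo)%E. Proof. by rewrite muI1 ltry. Qed.

Lemma I01_not_negligible : ~ {ae mu, forall x, ~ I x}.
Proof.
move=> [A [mA A0 subA]].
have : (mu I <= mu A)%E.
  by apply: le_measure; rewrite ?inE// => x Ix; apply: subA => /=; exact.
by rewrite muI1 A0 lee_fin ler10.
Qed.

Lemma Lnorm2_sqr (f : R -> R) :
  ('N[mu]_2%:E[EFin \o f \_ I] `^ 2 = \int[mu]_(x in I) (f x ^+ 2)%:E)%E.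
Proof.
rewrite poweR_Lnorm// [RHS]integral_mkcond; apply: eq_integral => x _.
rewrite /= !patchE; case: ifPn => xI /=; last by rewrite normr0 powR0.
by rewrite powR_mulrn// real_normK ?num_real.
Qed.

Lemma integrable_cst_I01 (r : R) : mu.-integrable I (EFin \o cst r).
Proof.
apply: (@integrable_bounded_ereal _ _ _ _ _ _ _ `|r|) => //.
by apply/measurable_EFinP; exact: measurable_cst.
Qed.

Lemma finite_norm2_integrable (g : R -> R) : measurable_fun I g ->
  finite_norm mu 2%:E (g \_ I) -> mu.-integrable I (EFin \o g).
Proof.
move=> mg /(@poweR_lty _ _ 2); rewrite Lnorm2_sqr => g2_oo.
apply: (@le_integrable _ _ _ mu I mI _ (fun x => 1 + (g x ^+ 2)%:E)%E).
- exact/measurable_EFinP.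
- move=> x Ix /=; rewrite lee_fin [leRHS]ger0_norm ?addr_ge0 ?sqr_ge0//.
  rewrite -(real_normK (num_real (g x))).
  (* Expanding the square gives |g| <= g^2 + 1/4, hence the domination by 1 + g^2. *)
  by have := sqr_ge0 (`|g x| - 1 / 2); nra.
- apply: (@integrableD _ _ _ mu I mI (cst 1%E) (fun x => (g x ^+ 2)%:E)).
    exact: integrable_cst_I01.
  apply/integrableP; split.
    by apply/measurable_EFinP; exact: measurable_funX.
  move: g2_oo; congr (_ < _)%E; apply: eq_integral => x _.
  by rewrite /= ger0_norm ?sqr_ge0.
Qed.

(** The bound K makes the norm finite, since [fine] would turn an infinite norm into 0. A zero norm
    would make f vanish almost everywhere on an interval of measure 1. *)
Lemma l2norm_gt0 (f : R -> R) (K : R) : measurable_fun I f ->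
  (forall x, I x -> 0 < f x) -> (forall x, I x -> f x <= K) -> 0 < l2norm f.
Proof.
move=> mf f0 fK; rewrite /l2norm.
have mfI : measurable_fun setT (EFin \o f \_ I).
  by apply/measurable_EFinP; apply/(measurable_restrictT f mI).
have n0 : ('N[mu]_2%:E[EFin \o f \_ I] != 0)%E.
  apply/eqP => /Lnorm_eq0_eq0 => /(_ mfI (ltr0Sn _ _)) f_eq0.
  apply: I01_not_negligible; apply: filterS f_eq0 => x /= /(_ Logic.I) + Ix.
  by rewrite patchE mem_set// => -[] /eqP; rewrite gt_eqF ?f0.
have noo : ('N[mu]_2%:E[EFin \o f \_ I] < +oo)%E.
  apply: (@lty_poweRy _ _ 2) => //; rewrite Lnorm2_sqr.
  apply: integrable_lty => //.
  apply: (@integrable_bounded_ereal _ _ _ _ _ _ _ (K ^+ 2)) => //.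
    by apply/measurable_EFinP; exact: measurable_funX.
  move=> x Ix /=; rewrite lee_fin ger0_norm ?sqr_ge0//.
  by rewrite lerXn2r ?nnegrE ?fK// ltW ?f0// (lt_le_trans (f0 _ Ix))// fK.
by rewrite fine_gt0// noo andbT lt0e n0 Lnorm_ge0.
Qed.
End l2norm_unit_interval.

(** * The tilted kernel on the unit interval *)

Section tilted_kernel.
Context {R : realType}.
Local Notation mu := (leb R).
Local Notation I := (I01 R).
Variables (P : R -> R -> R) (phi : R -> R) (M c C : R).
Hypothesis mP : measurable_fun (I `*` I) (fun z : R * R => P z.1 z.2).
Hypothesis P_ge0 : forall x y, I x -> I y -> 0 <= P x y.
Hypothesis P_leM : forall x y, I x -> I y -> P x y <= M.
Hypothesis P_mass : forall x, I x -> \int[mu]_(y in I) P x y = 1.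
Hypothesis mphi : measurable_fun I phi.
Hypothesis c_gt0 : 0 < c.
Hypothesis c_phi : forall x, I x -> c <= phi x.
Hypothesis phi_C : forall x, I x -> phi x <= C.

Let mI := @measurable_I01 R.
Let muI1 := @lebesgue_measure_I01 R.
Let muI_oo : (mu I < +oo)%E. Proof. by rewrite muI1 ltry. Qed.

Let phi_gt0 x : I x -> 0 < phi x.
Proof. by move=> /c_phi; exact: lt_le_trans. Qed.

Let M_ge0 : 0 <= M.
Proof.
have I0 : I 0 by apply/I01P; rewrite lexx ler01.
exact: le_trans (P_ge0 I0 I0) (P_leM I0 I0).
Qed.

Let C_gt0 : 0 < C.
Proof.
have I0 : I 0 by apply/I01P; rewrite lexx ler01.
exact: lt_le_trans (phi_gt0 I0) (phi_C I0).
Qed.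

Lemma stochasticP : stochastic mu I P.
Proof.
split=> // x Ix.
by have := @Rintegral_neq0 _ _ _ mu I (P x); rewrite P_mass// oner_neq0 => ->.
Qed.

Let mPx x : I x -> measurable_fun I (P x).
Proof. by move=> Ix; exact: (measurable_pair1_setX mI mP). Qed.

Let mPy y : I y -> measurable_fun I (P ^~ y).
Proof. by move=> Iy; exact: (measurable_pair2_setX mI mP). Qed.

Let phiP_ge0 x y : I x -> I y -> 0 <= phi y * P x y.
Proof. by move=> Ix Iy; rewrite mulr_ge0 ?P_ge0// ltW// phi_gt0. Qed.

Let phiP_le x y : I x -> I y -> phi y * P x y <= C * M.
Proof.
move=> Ix Iy; apply: ler_pM; rewrite ?P_ge0 ?phi_C ?P_leM//.
by rewrite ltW// phi_gt0.
Qed.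

(** This is the function w of the overview. *)
Definition mass (x : R) : R := \int[mu]_(y in I) (phi y * P x y).

Let massE x : I x -> ((mass x)%:E = \int[mu]_(y in I) (phi y * P x y)%:E)%E.
Proof.
move=> Ix; rewrite /mass RintegralE//.
apply: (@integrable_bounded_ereal _ _ _ _ _ _ _ (C * M)) => //.
- by apply/measurable_EFinP; apply: measurable_funM => //; exact: mPx.
- by move=> y Iy /=; rewrite lee_fin ger0_norm ?phiP_ge0 ?phiP_le.
Qed.

(** [mass x] is the average of phi under the probability P(x, .), so it inherits the bounds of
    phi. *)
Lemma mass_ge x : I x -> c <= mass x.
Proof.
move=> Ix; rewrite -lee_fin massE//.
have [_ _ /(_ x Ix) P1] := stochasticP.
rewrite -[leLHS]mule1 -P1 -ge0_integralZl//; last 3 first.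
- by apply/measurable_EFinP; exact: mPx.
- by move=> y Iy; rewrite lee_fin P_ge0.
- by rewrite lee_fin ltW.
apply: ge0_le_integral => //.
- by move=> y Iy; rewrite -EFinM lee_fin mulr_ge0 ?P_ge0// ltW.
- by apply: measurable_funeM; apply/measurable_EFinP; exact: mPx.
- by apply/measurable_EFinP; apply: measurable_funM => //; exact: mPx.
- by move=> y Iy; rewrite -EFinM lee_fin ler_wpM2r ?P_ge0 ?c_phi.
Qed.

Lemma mass_le x : I x -> mass x <= C.
Proof.
move=> Ix; rewrite -lee_fin massE//.
have [_ _ /(_ x Ix) P1] := stochasticP.
rewrite -[leRHS]mule1 -P1 -ge0_integralZl//; last 3 first.
- by apply/measurable_EFinP; exact: mPx.
- by move=> y Iy; rewrite lee_fin P_ge0.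
- by rewrite lee_fin ltW.
apply: ge0_le_integral => //.
- by move=> y Iy; rewrite lee_fin phiP_ge0.
- by apply/measurable_EFinP; apply: measurable_funM => //; exact: mPx.
- by apply: measurable_funeM; apply/measurable_EFinP; exact: mPx.
- by move=> y Iy; rewrite -EFinM lee_fin ler_wpM2r ?P_ge0 ?phi_C.
Qed.

Lemma mass_gt0 x : I x -> 0 < mass x.
Proof. by move=> /mass_ge; exact: lt_le_trans. Qed.

Lemma measurable_mass : measurable_fun I mass.
Proof.
apply/measurable_EFinP.
apply: (eq_measurable_fun (fun x => \int[mu]_(y in I) (phi y * P x y)%:E)%E).
  by move=> x /set_mem Ix; rewrite /= massE.
apply: (measurable_integral_setX1 mu mI
  (F := fun z : R * R => (phi z.2 * P z.1 z.2)%:E)).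
  apply/measurable_EFinP; apply: measurable_funM => //.
  exact: measurable_snd_setX.
by move=> x y Ix Iy; rewrite lee_fin phiP_ge0.
Qed.

Lemma jump_rateE x : I x -> jump_rate phi P x = mass x / phi x.
Proof.
move=> Ix; rewrite mulrC /mass -ge0_RintegralZl//.
- by apply: eq_Rintegral => y _; rewrite mulrA (mulrC _^-1).
- by apply: measurable_funM => //; exact: mPx.
- by move=> y Iy; rewrite phiP_ge0.
- by rewrite invr_gt0 phi_gt0.
Qed.

(** This is the kernel Q of the overview. By [jump_rateE] it agrees with [jump_kernel] on the unit
    square. *)
Definition tilted (x y : R) : R := phi y * P x y / mass x.

Lemma tilted_stochastic : stochastic mu I tilted.
Proof.
have t0 x y : I x -> I y -> 0 <= tilted x y.
  by move=> Ix Iy; rewrite mulr_ge0 ?phiP_ge0// invr_ge0 ltW ?mass_gt0.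
split=> // [|x Ix].
  apply: measurable_funM.
    by apply: measurable_funM => //; exact: measurable_snd_setX.
  apply: measurable_funV_gt0 => [|z [Iz _]]; last exact: mass_gt0.
  exact: (measurable_fst_setX mI measurable_mass).
under eq_integral do rewrite /tilted mulrC EFinM.
rewrite ge0_integralZl//.
- by rewrite -massE// -EFinM mulVf// gt_eqF// mass_gt0.
- by apply/measurable_EFinP; apply: measurable_funM => //; exact: mPx.
- by move=> y Iy; rewrite lee_fin phiP_ge0.
- by rewrite lee_fin invr_ge0 ltW ?mass_gt0.
Qed.

Lemma tilted_eq0 x y : I x -> I y -> tilted x y = 0 -> P x y = 0.
Proof.
move=> Ix Iy /eqP; rewrite /tilted !mulf_eq0 invr_eq0.
rewrite (gt_eqF (phi_gt0 Iy)) (gt_eqF (mass_gt0 Ix)) orbF.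
by move/eqP.
Qed.

Lemma tilted_le x y : I x -> I y -> tilted x y <= C * M / c.
Proof.
move=> Ix Iy; rewrite /tilted; apply: ler_pM; rewrite ?phiP_ge0 ?phiP_le//.
- by rewrite invr_ge0 ltW ?mass_gt0.
- by rewrite lef_pV2 ?posrE ?mass_gt0// mass_ge.
Qed.

(** The weight [mass y] cancels the normalization of [tilted], leaving the integral against P of the
    original equations. *)
Lemma push_tilted (g : R -> R) x : I x ->
  push mu I tilted (fun y => (mass y * g y)%:E) x =
  (\int[mu]_(y in I) (phi x * (g y * P y x))%:E)%E.
Proof.
move=> Ix; apply: eq_integral => y /set_mem Iy; rewrite -EFinM; congr EFin.
by rewrite /tilted; field; rewrite gt_eqF ?mass_gt0.
Qed.

Lemma dual_generatorE (g : R -> R) x : I x ->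
  dual_generator phi P g x =
  fine (push mu I tilted (fun y => (mass y * (g y / phi y))%:E) x)
  - mass x * (g x / phi x).
Proof.
move=> Ix; rewrite /dual_generator jump_rateE// push_tilted//; congr (_ - _).
  apply: eq_Rintegral => y /set_mem Iy.
  by field; rewrite gt_eqF// phi_gt0.
by field; rewrite gt_eqF// phi_gt0.
Qed.

Let ge0_mass_mul (g : R -> R) : measurable_fun I g ->
  (forall x, I x -> 0 <= g x) ->
  ge0_measurable I (fun x => (mass x * g x)%:E).
Proof.
move=> mg g0; split.
  apply/measurable_EFinP; apply: measurable_funM => //.
  exact: measurable_mass.
by move=> x Ix; rewrite lee_fin mulr_ge0 ?g0// ltW ?mass_gt0.
Qed.

(** Multiplying the equation for l by phi(x) l(x) turns it into invariance of [mass] times l under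
    [tilted]. *)
Lemma is_ellE (l : R -> R) : is_ell phi P l <->
  [/\ measurable_fun I l, (forall x, I x -> 0 < l x) &
    forall x, I x -> push mu I tilted (fun y => (mass y * l y)%:E) x =
      (mass x * l x)%:E].
Proof.
have fine_push x : measurable_fun I l -> (forall x, I x -> 0 < l x) -> I x ->
    fine (push mu I tilted (fun y => (mass y * l y)%:E) x) =
    phi x * \int[mu]_(y in I) (l y * P y x).
  move=> ml l0 Ix; rewrite push_tilted// -ge0_RintegralZl//.
  - by apply: measurable_funM => //; exact: mPy.
  - by move=> y Iy; rewrite mulr_ge0 ?P_ge0// ltW ?l0.
  - exact: phi_gt0.
split => [[ml l0 lE]|[ml l0 lE]].
  have l0' x : I x -> 0 < l x by move=> /I01P; exact: l0.
  split=> // x Ix.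
  have : fine (push mu I tilted (fun y => (mass y * l y)%:E) x) = mass x * l x.
    rewrite fine_push//; move/I01P : (Ix) => /lE.
    rewrite jump_rateE// => lxE.
    rewrite -[X in phi x * X](mulVKf (lt0r_neq0 (l0' _ Ix))) lxE.
    by field; rewrite gt_eqF// phi_gt0.
  (* Positivity rules out an infinite [push], for which [fine] would give 0. *)
  have : 0 < mass x * l x by rewrite mulr_gt0 ?mass_gt0 ?l0'.
  by case: push => //= [r _ ->//||]; move=> /lt_eqF/eqP.
split=> // x /I01P Ix.
have /(congr1 fine) := lE x Ix; rewrite fine_push//= jump_rateE// => lxE.
rewrite -[X in _^-1 * X](mulKf (lt0r_neq0 (phi_gt0 Ix))) lxE.
by field; rewrite !gt_eqF ?phi_gt0 ?l0.
Qed.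

(** * Solutions of the equation for l and invariant probabilities *)

Variable theta : R -> R.
Hypothesis theta_inv : invariant_density P theta.
Hypothesis theta_uniq : forall theta', invariant_density P theta' ->
  forall x, 0 <= x <= 1 -> theta' x = theta x.
Hypothesis theta_gt0 : forall x, 0 <= x <= 1 -> 0 < theta x.

Let is_density_ge0 g : is_density g -> ge0_measurable I (EFin \o g).
Proof.
move=> [mg g0 _]; split; first exact/measurable_EFinP.
by move=> x /I01P Ix; rewrite lee_fin g0.
Qed.

Let integral_density g : is_density g ->
  (\int[mu]_(x in I) (g x)%:E = 1)%E.
Proof. by move=> [_ _ g1]; rewrite Rintegral_neq0 g1// oner_neq0. Qed.

Let theta_push x : I x -> push mu I P (EFin \o theta) x = (theta x)%:E.
Proof.
move=> Ix; have [_ /(_ x Ix) tx] := theta_inv.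
rewrite /push -tx -Rintegral_neq0//; first by rewrite tx gt_eqF// theta_gt0.
Qed.

Let invariant_gt0 t : ge0_measurable I t ->
  (forall x, I x -> t x \is a fin_num) -> (\int[mu]_(x in I) t x = 1)%E ->
  (forall x, I x -> push mu I P t x = t x) -> forall x, I x -> (0 < t x)%E.
Proof.
move=> [mt t0] tfin t1 tE x Ix.
have fineE y : I y -> t y = (fine (t y))%:E by move=> Iy; rewrite fineK ?tfin.
suff tinv : invariant_density P (fine \o t).
  rewrite fineE// lte_fin; have /= -> := theta_uniq tinv Ix.
  exact: theta_gt0.
split; first split.
- exact: measurableT_comp.
- by move=> y Iy; rewrite fine_ge0// t0.
- rewrite /Rintegral -[RHS]/(fine 1%E) -t1; congr fine.
  by apply: eq_integral => y /set_mem Iy; rewrite -fineE.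
- move=> y Iy; rewrite /= -tE// /Rintegral /push; congr fine.
  by apply: eq_integral => z /set_mem Iz; rewrite EFinM -fineE.
Qed.

Let theta_oo : (\int[mu]_(x in I) (theta x)%:E < +oo)%E.
Proof. by rewrite integral_density ?ltry//; have [] := theta_inv. Qed.

Let exists_h : exists h, [/\ ge0_measurable I h,
    forall x, I x -> push mu I tilted h x = h x,
    (0 < \int[mu]_(x in I) h x < +oo)%E &
    forall x, I x -> h x \is a fin_num].
Proof.
have muI : (0 < mu I < +oo)%E by rewrite muI_oo andbT muI1 lte01.
exact: (exists_push_invariant (mu := mu) mI tilted_stochastic tilted_le muI).
Qed.

(** An invariant function h of [tilted] with positive integral is positive everywhere by the
    zero-one law; l is h divided by [mass]. *)
Lemma exists_ell : exists l, is_ell phi P l.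
Proof.
have [h [gh hE /andP[h_gt0 _] hfin]] := exists_h.
have [h0|h0] := invariant_zero_one (mu := mu) mI stochasticP
  tilted_stochastic tilted_eq0
  (is_density_ge0 theta_inv.1) (fun _ _ => erefl) theta_gt0 theta_oo
  theta_push invariant_gt0 gh hE.
  move: h_gt0; rewrite (eq_integral (cst 0%E)) ?integral0 ?ltxx//.
  by move=> x /set_mem Ix; rewrite h0.
have [mh _] := gh.
have massK x : I x -> (mass x * (fine (h x) / mass x))%:E = h x.
  by move=> Ix; rewrite mulrCA divff ?mulr1 ?fineK ?hfin// gt_eqF ?mass_gt0.
exists (fun x => fine (h x) / mass x); apply/is_ellE; split.
- apply: measurable_funM; first exact: measurableT_comp.
  by apply: measurable_funV_gt0; [exact: measurable_mass|exact: mass_gt0].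
- move=> x Ix; rewrite divr_gt0 ?mass_gt0// fine_gt0// h0//=.
  by rewrite -ge0_fin_numE ?hfin// ltW// h0.
- move=> x Ix; rewrite massK// -[RHS]hE//; apply: eq_integral => y /set_mem Iy.
  by rewrite massK.
Qed.

(** The definition of l contains no integrability. Comparison with an integrable invariant h makes
    [mass] times l integrable, and invariance under a bounded kernel then bounds it. The bound
    ensures that the L^2 norm of l is finite. *)
Lemma ell_bounded l : is_ell phi P l ->
  exists2 K : R, 0 < K & forall x, I x -> l x <= K.
Proof.
move=> /is_ellE[ml l0 lE]; have [h [gh hE hoo hfin]] := exists_h.
have l0' x : I x -> 0 <= l x by move=> Ix; rewrite ltW ?l0.
have gl := ge0_mass_mul ml l0'.
have loo := ae_invariant_integrable (mu := mu) mI stochasticP tilted_stochastic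
  tilted_eq0 (is_density_ge0 theta_inv.1) (fun _ _ => erefl) theta_gt0 theta_oo
  theta_push invariant_gt0 gh gl hfin (fun _ _ => erefl) hoo (aeW mu hE)
  (aeW mu lE).
pose S := fine (\int[mu]_(x in I) (mass x * l x)%:E)%E.
have SE : (\int[mu]_(x in I) (mass x * l x)%:E = S%:E)%E.
  by rewrite fineK// ge0_fin_numE// integral_ge0//; have [_] := gl.
(* Here C M / c bounds [tilted], S is the integral of [mass] times l, and the factor 1/c comes from
   c l <= [mass] l. *)
have bnd x : I x -> l x <= c^-1 * (C * M / c * S).
  move=> Ix; rewrite ler_pdivlMl//.
  apply: (@le_trans _ _ (mass x * l x)).
    by rewrite ler_wpM2r ?l0' ?mass_ge.
  rewrite -lee_fin -lE// EFinM -SE.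
  apply: (push_le_bound (mu := mu) mI tilted_stochastic gl) => // y Iy.
  exact: tilted_le.
exists (Num.max 1 (c^-1 * (C * M / c * S))); first by rewrite lt_max ltr01.
by move=> x Ix; rewrite le_max bnd ?orbT.
Qed.


(** Division by phi reduces the claim to invariance of [mass] times l. The scalar a covers both
    [mu_density] and its normalization. *)
Lemma dual_generator_ell l a x : is_ell phi P l -> 0 <= a -> I x ->
  dual_generator phi P (fun y => a * (phi y * l y)) x = 0.
Proof.
move=> /is_ellE[ml l0 lE] a0 Ix; rewrite dual_generatorE//.
have l0' y : I y -> 0 <= l y by move=> Iy; rewrite ltW ?l0.
have -> : push mu I tilted
    (fun y => (mass y * (a * (phi y * l y) / phi y))%:E) x =
  push mu I tilted (fun y => (a%:E * (mass y * l y)%:E)%E) x.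
  apply: eq_integral => y /set_mem Iy; rewrite -!EFinM; congr EFin.
  by field; rewrite gt_eqF ?phi_gt0.
rewrite (pushZ (mu := mu) mI tilted_stochastic (ge0_mass_mul ml l0'))// lE//=.
by field; rewrite gt_eqF ?phi_gt0.
Qed.

(** The functions G g1 and G g2 are invariant under [tilted], so the dichotomy orders them almost
    everywhere, and so also g1 and g2, whose integrals are both 1. *)
Lemma invariant_probability_unique g1 g2 :
  invariant_probability phi P g1 -> invariant_probability phi P g2 ->
  {ae mu, forall x, 0 <= x <= 1 -> g1 x = g2 x}.
Proof.
pose G (g : R -> R) (x : R) : \bar R := (mass x * (g x / phi x))%:E.
have mVphi : measurable_fun I (fun x => (phi x)^-1).
  exact: measurable_funV_gt0.
have gG g : is_density g -> ge0_measurable I (G g).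
  move=> [mg g0 _]; apply: ge0_mass_mul; first exact: measurable_funM.
  by move=> x Ix; rewrite divr_ge0 ?g0// ltW ?phi_gt0.
have Goo g : is_density g -> (\int[mu]_(x in I) G g x < +oo)%E.
  move=> dg; have [mg g0 _] := dg.
  apply: (@le_lt_trans _ _ (\int[mu]_(x in I) ((C / c)%:E * (g x)%:E))%E).
    have [mG G0] := gG g dg; apply: ge0_le_integral => //.
      by apply: measurable_funeM; exact/measurable_EFinP.
    move=> x Ix; rewrite -EFinM lee_fin mulrCA mulrC ler_wpM2r ?g0//.
    apply: ler_pM; [by rewrite ltW ?mass_gt0| |exact: mass_le|].
      by rewrite invr_ge0 ltW ?phi_gt0.
    by rewrite lef_pV2 ?posrE ?phi_gt0 ?c_phi.
  rewrite ge0_integralZl// ?integral_density ?mule1 ?ltry//.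
    exact/measurable_EFinP.
  by rewrite lee_fin divr_ge0 ?ltW.
have GE g : invariant_probability phi P g ->
    ae_eq mu I (push mu I tilted (G g)) (G g).
  move=> [dg ig]; apply: (ae_imply _ ig) => x gx Ix; move: (gx Ix).
  rewrite dual_generatorE// => /eqP; rewrite subr_eq0 => /eqP pE.
  rewrite /G -pE fineK//.
  by apply: (push_fin_num (mu := mu) mI (M := C * M / c) tilted_stochastic
    (gG g dg)); [move=> y Iy; exact: tilted_le|exact: Goo|].
(* In the other alternative of the dichotomy the two densities exchange roles. *)
wlog g12 : g1 g2 / {ae mu, forall x, I x -> (G g1 x <= G g2 x)%E}.
  move=> wg i1 i2; have [d1 _] := i1; have [d2 _] := i2.
  have [g12|g21] := ae_invariant_dichotomy (mu := mu) mI stochasticP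
    tilted_stochastic tilted_eq0 (is_density_ge0 theta_inv.1) (fun _ _ => erefl)
    theta_gt0 theta_oo theta_push invariant_gt0 (gG g1 d1) (gG g2 d2)
    (fun _ _ => erefl) (Goo g1 d1) (GE g1 i1) (GE g2 i2).
    exact: wg.
  have : {ae mu, forall x, 0 <= x <= 1 -> g2 x = g1 x}.
    by apply: wg => //; apply: (ae_imply _ g21) => x gx Ix; rewrite ltW ?gx.
  by apply: ae_imply => x gx Ix; rewrite gx.
move=> [d1 _] [d2 _].
have : ae_eq mu I (EFin \o g1) (EFin \o g2).
  apply: (ae_eq_le_integral (mu := mu) mI
    (is_density_ge0 d1) (is_density_ge0 d2)).
  - apply: (ae_imply _ g12) => x gx Ix; move: (gx Ix); rewrite !lee_fin.
    by rewrite ler_pM2l ?mass_gt0// ler_pM2r// invr_gt0 phi_gt0.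
  - by rewrite !integral_density.
  - by rewrite integral_density// ltry.
by apply: ae_imply => x gx Ix; have [] := gx Ix.
Qed.

Lemma ell_invariant_probability l : is_ell phi P l ->
  [/\ (forall x, 0 <= x <= 1 ->
         dual_generator phi P (mu_density phi l) x = 0),
      invariant_probability phi P (normalize (mu_density phi l)) &
      forall g, invariant_probability phi P g ->
        {ae mu, forall x, 0 <= x <= 1 ->
           g x = normalize (mu_density phi l) x}].
Proof.
move=> el; have [ml l0 _] := (is_ellE l).1 el; have [K K0 lK] := ell_bounded el.
pose N := l2norm phi * l2norm l.
have N0 : 0 < N.
  by rewrite mulr_gt0 ?(l2norm_gt0 mphi phi_gt0 phi_C) ?(l2norm_gt0 ml l0 lK).
have muE : mu_density phi l = fun x => N^-1 * (phi x * l x).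
  by apply/funext => x; rewrite /mu_density mulrC.
pose J := \int[mu]_(y in I) mu_density phi l y.
have mdens : measurable_fun I (mu_density phi l).
  rewrite muE; apply: measurable_funM; first exact: measurable_cst.
  exact: measurable_funM.
have dens0 x : I x -> 0 < mu_density phi l x.
  by move=> Ix; rewrite muE !mulr_gt0 ?invr_gt0 ?phi_gt0 ?l0.
have idens : mu.-integrable I (EFin \o mu_density phi l).
  apply: (@integrable_bounded_ereal _ _ _ _ _ _ _ (N^-1 * (C * K))) => //.
    exact/measurable_EFinP.
  move=> x Ix /=; rewrite lee_fin ger0_norm; last by rewrite ltW ?dens0.
  rewrite muE ler_pM2l ?invr_gt0//.
  apply: ler_pM; [by rewrite ltW ?phi_gt0|by rewrite ltW ?l0| |exact: lK].
  exact: phi_C.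
(* Since the density is integrable, J = 0 would be a genuine zero integral and not the default
   value, so a positive function would vanish almost everywhere. *)
have J0 : 0 < J.
  rewrite lt0r Rintegral_ge0 ?andbT => [|x Ix]; last by rewrite ltW ?dens0.
  apply/eqP => J_eq0; apply: I01_not_negligible.
  have : (\int[mu]_(x in I) (mu_density phi l x)%:E = 0)%E.
    by rewrite RintegralE// -/J J_eq0.
  move/(ge0_integral_eq0 (mu := mu) mI) => dens_eq0.
  have /dens_eq0 : ge0_measurable I (EFin \o mu_density phi l).
    split; first exact/measurable_EFinP.
    by move=> x Ix; rewrite lee_fin ltW ?dens0.
  apply: ae_imply => x + Ix => /(_ Ix) [] /eqP.
  by rewrite gt_eqF ?dens0.
have nE : normalize (mu_density phi l) = fun x => (J^-1 / N) * (phi x * l x).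
  by apply/funext => x; rewrite /normalize -/J muE; ring.
have inv : invariant_probability phi P (normalize (mu_density phi l)).
  split; first split.
  - rewrite nE; apply: measurable_funM; first exact: measurable_cst.
    exact: measurable_funM.
  - by move=> x Ix; rewrite /normalize -/J divr_ge0 ?ltW ?dens0.
  - by rewrite /normalize RintegralZr// -/J divff ?gt_eqF.
  - apply: aeW => x Ix; rewrite nE dual_generator_ell//.
    by rewrite divr_ge0 ?invr_ge0 ?ltW.
split=> //.
  by move=> x Ix; rewrite muE dual_generator_ell// invr_ge0 ltW.
by move=> g ig; exact: invariant_probability_unique.
Qed.


(** * The generator and its dual in L^2 *)

Let kernel x y := phi y / phi x * P x y.

Let mkernel : measurable_fun (I `*` I) (fun z : R * R => kernel z.1 z.2).
Proof.
apply: measurable_funM => //; apply: measurable_funM.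
  exact: measurable_snd_setX.
apply: (measurable_fst_setX mI (f := fun x => (phi x)^-1)).
exact: measurable_funV_gt0.
Qed.

Let kernel_bound x y : I x -> I y -> `|kernel x y| <= C / c * M.
Proof.
move=> Ix Iy; rewrite ger0_norm; last first.
  by rewrite mulr_ge0 ?P_ge0// divr_ge0// ltW ?phi_gt0.
apply: ler_pM; [by rewrite divr_ge0// ltW ?phi_gt0|exact: P_ge0| |exact: P_leM].
apply: ler_pM; [by rewrite ltW ?phi_gt0|by rewrite invr_ge0 ltW ?phi_gt0| |].
  exact: phi_C.
by rewrite lef_pV2 ?posrE ?phi_gt0 ?c_phi.
Qed.

Let integrable_kernel (f : R -> R) x : mu.-integrable I (EFin \o f) -> I x ->
  mu.-integrable I (fun y => (kernel x y * f y)%:E).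
Proof.
move=> intf Ix.
apply: (integrable_mul_bounded (mu := mu) (f := kernel x)
  (K := C / c * M) mI intf).
  exact: (measurable_pair1_setX mI mkernel Ix).
by move=> y Iy; exact: kernel_bound.
Qed.

Let integrable_kernel2 (f : R -> R) y : mu.-integrable I (EFin \o f) -> I y ->
  mu.-integrable I (fun x => (kernel x y * f x)%:E).
Proof.
move=> intf Iy.
apply: (integrable_mul_bounded (mu := mu) (f := kernel ^~ y)
  (K := C / c * M) mI intf).
  exact: (measurable_pair2_setX mI mkernel Iy).
by move=> x Ix; exact: kernel_bound.
Qed.

Let bounded_integrable (f : R -> R) :
  measurable_fun I f -> [bounded f x | x in I] -> mu.-integrable I (EFin \o f).
Proof. by move=> mf bf; exact: measurable_bounded_integrable. Qed.

(** The jump rate is nonzero, so it cancels against the denominator of [jump_kernel]; boundedness of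
    f gives the integrability needed to pull it out of the integral. *)
Lemma generator_jump_kernel (f : R -> R) x :
  measurable_fun I f -> [bounded f x | x in I] -> I x ->
  generator phi P f x =
  jump_rate phi P x * \int[mu]_(y in I) ((f y - f x) * jump_kernel phi P x y).
Proof.
move=> mf bf Ix.
have jr0 : jump_rate phi P x != 0.
  by rewrite jump_rateE// mulf_neq0// ?invr_neq0// gt_eqF ?mass_gt0 ?phi_gt0.
have integrable_f : mu.-integrable I (fun y => (f y - f x)%:E).
  apply: (@integrableB _ _ _ mu I mI (EFin \o f) (fun=> (f x)%:E)).
    exact: bounded_integrable.
  exact: integrable_cst_I01.
have jk y : (f y - f x) * jump_kernel phi P x y =
    (jump_rate phi P x)^-1 * (kernel x y * (f y - f x)).
  by rewrite /jump_kernel /kernel; field; rewrite jr0 gt_eqF ?phi_gt0.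
under eq_Rintegral do rewrite jk.
rewrite RintegralZl//; last exact: integrable_kernel.
rewrite mulVKf//; apply: eq_Rintegral => y _.
by rewrite /kernel; ring.
Qed.

Let generatorE (f : R -> R) x : mu.-integrable I (EFin \o f) -> I x ->
  generator phi P f x =
  \int[mu]_(y in I) (kernel x y * f y) - f x * jump_rate phi P x.
Proof.
move=> intf Ix; rewrite /jump_rate -RintegralZl//; last first.
  have := integrable_kernel (integrable_cst_I01 1) Ix.
  by apply: eq_integrable => // y _; rewrite /= mulr1.
rewrite -RintegralB//; last 2 first.
- exact: integrable_kernel.
- have := integrable_kernel (integrable_cst_I01 (f x)) Ix.
  by apply: eq_integrable => // y _; rewrite /= mulrC.
by apply: eq_Rintegral => y _; rewrite /kernel; ring.
Qed.

Let measurable_jump_rate : measurable_fun I (jump_rate phi P).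
Proof.
apply: (eq_measurable_fun (fun x => mass x / phi x)).
  by move=> x /set_mem Ix; rewrite jump_rateE.
by apply: measurable_funM; [exact: measurable_mass|exact: measurable_funV_gt0].
Qed.

Let jump_rate_bound x : I x -> `|jump_rate phi P x| <= C / c.
Proof.
move=> Ix; rewrite jump_rateE// ger0_norm; last first.
  by rewrite divr_ge0// ltW ?mass_gt0 ?phi_gt0.
apply: ler_pM; [by rewrite ltW ?mass_gt0|by rewrite invr_ge0 ltW ?phi_gt0| |].
  exact: mass_le.
by rewrite lef_pV2 ?posrE ?phi_gt0 ?c_phi.
Qed.

(** The generator is an integral operator minus multiplication by the jump rate. Fubini transposes
    the first, and the second is symmetric. *)
Lemma generator_dual (f g : R -> R) :
  measurable_fun I f -> [bounded f x | x in I] ->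
  measurable_fun I g -> finite_norm mu 2%:E (g \_ I) ->
  \int[mu]_(x in I) (generator phi P f x * g x) =
  \int[mu]_(x in I) (f x * dual_generator phi P g x).
Proof.
move=> mf bf mg /(finite_norm2_integrable mg) intg.
have intf := bounded_integrable mf bf; have [K K0 fK] := bounded_on_le bf.
pose A x y := g x * (kernel x y * f y).
have mA : measurable_fun (I `*` I) (fun z : R * R => A z.1 z.2).
  apply: measurable_funM; first exact: measurable_fst_setX.
  by apply: measurable_funM => //; exact: measurable_snd_setX.
have mAt : measurable_fun (I `*` I) (fun z : R * R => A z.2 z.1).
  have := measurable_comp (measurableX mI mI) _ mA
    (measurable_funTS (@measurable_swap _ _ _ _)).
  by apply => _ [z [/= Iz1 Iz2] <-].
have intA x : I x -> mu.-integrable I (fun y => (A x y)%:E).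
  move=> Ix.
  have := integrableZl (mu := mu) mI (g x) (integrable_kernel intf Ix).
  by apply: eq_integrable.
have intAt y : I y -> mu.-integrable I (fun x => (A x y)%:E).
  move=> Iy.
  have := integrableZl (mu := mu) mI (f y) (integrable_kernel2 intg Iy).
  by apply: eq_integrable => // x _; rewrite -EFinM /A; congr EFin; ring.
have A_oo : (\int[mu]_(x in I) \int[mu]_(y in I) `|(A x y)%:E| < +oo)%E.
  (* B bounds [kernel] times f, so |A(x, y)| <= B |g(x)|, and g is integrable because it is in L^2
     of a probability space. *)
  pose B := C / c * M * K.
  have B0 : 0 <= B by rewrite !mulr_ge0 ?invr_ge0// ltW.
  have mg' : measurable_fun I (fun x => `|(g x)%:E|%E).
    by apply: measurableT_comp => //; exact/measurable_EFinP.
  apply: (@le_lt_trans _ _ (\int[mu]_(x in I) (B%:E * `|(g x)%:E|))%E).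
    apply: ge0_le_integral => //.
    - by move=> x Ix; exact: integral_ge0.
    - apply: (measurable_integral_setX1 mu mI
        (F := fun z : R * R => `|(A z.1 z.2)%:E|%E)) => //.
      by apply: measurableT_comp => //; exact/measurable_EFinP.
    - exact: measurable_funeM.
    move=> x Ix; rewrite -[leRHS]mule1 -(lebesgue_measure_I01 (R := R)).
    apply: integral_le_bound => //.
    - by have /integrableP[] := intA x Ix.
    - by rewrite mule_ge0.
    apply: aeW => y Iy; rewrite -EFinM lee_fin /A normrM mulrC.
    rewrite ler_wpM2r// normrM.
    by rewrite /B; apply: ler_pM; rewrite ?kernel_bound ?fK.
  rewrite ge0_integralZl// lte_mul_pinfty//.
  by have /integrableP[] := intg.
have At_oo : (\int[mu]_(y in I) \int[mu]_(x in I) `|(A x y)%:E| < +oo)%E.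
  rewrite -(fubini_tonelli_setX mu mI
    (F := fun z : R * R => `|(A z.1 z.2)%:E|%E))//.
  by apply: measurableT_comp => //; exact/measurable_EFinP.
have [|iF1 F12] := Fubini_setX (mu := mu) mI
    (F := fun z : R * R => (A z.1 z.2)%:E) _ A_oo.
  exact/measurable_EFinP.
(* The transposed integrand is used only to obtain integrability of the other partial integral. *)
have [|iF2 _] := Fubini_setX (mu := mu) mI
    (F := fun z : R * R => (A z.2 z.1)%:E) _ At_oo.
  exact/measurable_EFinP.
have int_fjg : mu.-integrable I (fun x => (f x * jump_rate phi P x * g x)%:E).
  apply: (@integrable_mul_bounded _ _ _ mu I mI _ _ (K * (C / c))) => //.
    exact: measurable_funM.
  by move=> x Ix; rewrite normrM; apply: ler_pM; rewrite ?fK ?jump_rate_bound.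
pose F x := \int[mu]_(y in I) A x y; pose G y := \int[mu]_(x in I) A x y.
have FE x : I x -> ((F x)%:E = \int[mu]_(y in I) (A x y)%:E)%E.
  by move=> Ix; rewrite RintegralE// intA.
have GE y : I y -> ((G y)%:E = \int[mu]_(x in I) (A x y)%:E)%E.
  by move=> Iy; rewrite RintegralE// intAt.
have intF : mu.-integrable I (EFin \o F).
  by apply: eq_integrable iF1 => // x /set_mem Ix; rewrite /= FE.
have intG : mu.-integrable I (EFin \o G).
  by apply: eq_integrable iF2 => // x /set_mem Ix; rewrite /= GE.
have FG : \int[mu]_(x in I) F x = \int[mu]_(y in I) G y.
  congr fine; transitivity (\int[mu]_(x in I) \int[mu]_(y in I) (A x y)%:E)%E.
    by apply: eq_integral => x /set_mem Ix; rewrite FE.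
  by rewrite [LHS]F12; apply: eq_integral => y /set_mem Iy; rewrite GE.
transitivity (\int[mu]_(x in I) (F x - f x * jump_rate phi P x * g x)).
  apply: eq_Rintegral => x /set_mem Ix.
  rewrite generatorE// mulrBl; congr (_ - _).
  by rewrite mulrC -RintegralZl//; exact: integrable_kernel.
rewrite RintegralB// FG -RintegralB//.
apply: eq_Rintegral => y /set_mem Iy.
rewrite /dual_generator mulrBr mulrA; congr (_ - _).
rewrite -RintegralZl//.
  by apply: eq_Rintegral => x _; rewrite /A /kernel; ring.
have := integrable_kernel2 intg Iy.
by apply: eq_integrable => // x _; rewrite /= /kernel; congr EFin; ring.
Qed.

End tilted_kernel.

(** * Bounds from compactness and conclusion *)

(** The minimum is attained, so pointwise positivity becomes a uniform lower bound. *)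
Lemma continuous_bounds_I01 (R : realType) (f : R -> R) :
  {within I01 R, continuous f} -> (forall x, 0 <= x <= 1 -> 0 < f x) ->
  exists m M : R, [/\ 0 < m, forall x, I01 R x -> m <= f x &
    forall x, I01 R x -> f x <= M].
Proof.
move=> cf f0.
have [a aI fa] := EVT_min ler01 cf; have [b bI fb] := EVT_max ler01 cf.
exists (f a), (f b); split.
- by apply: f0; move: aI; rewrite in_itv.
- by move=> x Ix; exact: fa.
- by move=> x Ix; exact: fb.
Qed.

Lemma continuous_ubound_I01X (R : realType) (P : R * R -> R) :
  {within I01 R `*` I01 R, continuous P} ->
  exists M : R, forall x y, I01 R x -> I01 R y -> P (x, y) <= M.
Proof.
move=> cP.
have I0 : (I01 R `*` I01 R) !=set0.
  by exists (0, 0); split => /=; rewrite in_itv/= lexx ler01.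
have [c _ Pc] := compact_EVT_max I0
  (compact_setX (segment_compact (a := 0) (b := 1))
    (segment_compact (a := 0) (b := 1))) cP.
by exists (P c) => x y Ix Iy; apply: Pc; rewrite inE.
Qed.

Theorem theorem5 (R : realType) (P : R -> R -> R) (theta phi : R -> R)
  (P_cont : {within I01 R `*` I01 R,
               continuous (fun z : R * R => P z.1 z.2)})
  (P_ge0 : forall x y, 0 <= x <= 1 -> 0 <= y <= 1 -> 0 <= P x y)
  (P_mass : forall x, 0 <= x <= 1 -> \int[leb R]_(y in I01 R) P x y = 1)
  (theta_inv : invariant_density P theta)
  (theta_uniq : forall theta', invariant_density P theta' ->
     forall x, 0 <= x <= 1 -> theta' x = theta x)
  (theta_gt0 : forall x, 0 <= x <= 1 -> 0 < theta x)
  (theta_cont : {within I01 R, continuous theta})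
  (phi_gt0 : forall x, 0 <= x <= 1 -> 0 < phi x)
  (phi_cont : {within I01 R, continuous phi})
  (phi_bnd : [bounded phi x | x in I01 R]) :
  (* the two expressions of the generator agree *)
  (forall f : R -> R,
     measurable_fun (I01 R) f -> [bounded f x | x in I01 R] ->
     forall x, 0 <= x <= 1 ->
       generator phi P f x =
       jump_rate phi P x *
         \int[leb R]_(y in I01 R) ((f y - f x) * jump_kernel phi P x y))
  /\
  (* dual_generator is the dual of the generator in L^2([0,1], dx) *)
  (forall f g : R -> R,
     measurable_fun (I01 R) f -> [bounded f x | x in I01 R] ->
     measurable_fun (I01 R) g -> finite_norm (leb R) 2%:E (g \_ (I01 R)) ->
     \int[leb R]_(x in I01 R) (generator phi P f x * g x) =
     \int[leb R]_(x in I01 R) (f x * dual_generator phi P g x))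
  /\
  (exists l : R -> R, is_ell phi P l)
  /\
  (forall l : R -> R, is_ell phi P l ->
     [/\ (forall x, 0 <= x <= 1 ->
            dual_generator phi P (mu_density phi l) x = 0),
         invariant_probability phi P (normalize (mu_density phi l)) &
         forall g, invariant_probability phi P g ->
           {ae leb R, forall x, 0 <= x <= 1 ->
              g x = normalize (mu_density phi l) x}]).
Proof.
have mI := @measurable_I01 R.
have mP : measurable_fun (I01 R `*` I01 R) (fun z : R * R => P z.1 z.2).
  by apply: subspace_continuous_measurable_fun_prod => //; exact: measurableX.
have mphi : measurable_fun (I01 R) phi.
  exact: subspace_continuous_measurable_fun.
have [M PM] := continuous_ubound_I01X P_cont.
have [c [C [c0 cphi phiC]]] := continuous_bounds_I01 phi_cont phi_gt0.
split.
  move=> f mf bf x Ix.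
  exact: (generator_jump_kernel mP P_ge0 PM P_mass mphi c0 cphi phiC mf bf Ix).
split.
  move=> f g mf bf mg ng.
  exact: (generator_dual mP P_ge0 PM P_mass mphi c0 cphi phiC mf bf mg ng).
split.
  exact: (exists_ell mP P_ge0 PM P_mass mphi c0 cphi phiC theta_inv theta_uniq
    theta_gt0).
move=> l el.
exact: (ell_invariant_probability mP P_ge0 PM P_mass mphi c0 cphi phiC theta_inv
  theta_uniq theta_gt0 el).
Qed.
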